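(* Let $b(n,m)$ denote the number of Arndt compositions of $n$ whose last part equals $m$. Define $t_1(0)=1$, $t_1(1)=0$, $t_1(n)=F_{n-2}$ for $n\ge2$, and $t_2(0)=0$, $t_2(1)=1$, $t_2(n)=F_{n-1}$ for $n\ge 2$, where $F_n$ are the Fibonacci numbers ($F_0=0,F_1=1,F_n=F_{n-1}+F_{n-2}$). Then for all integers $n\ge 1$ and $m\ge 1$, $$b(n,m)=\begin{cases} t_1(n-m), & \text{if } m\leq n <2m,\\ t_1(n-m) + t_2(n-2m), & \text{if } 2m\leq n,\\ 0, & \text{otherwise.} \end{cases}$$
   Context: A composition of $n$ is a finite sequence $(\sigma_1,\dots,\sigma_\ell)$ of positive integers summing to $n$. An Arndt composition is one with $\sigma_{2i-1}>\sigma_{2i}$ for every positive integer $i$ with $2i\le\ell$. The last part of a nonempty composition is $\sigma_\ell$. *)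

(* Defs.v *)
From mathcomp Require Import all_boot.

Set Implicit Arguments.
Unset Strict Implicit.
Unset Printing Implicit Defensive.

Definition is_composition (n : nat) (s : seq nat) : bool :=
  all (fun x => 0 < x) s && (sumn s == n).

(* sigma_i with the usual 1-based indexing; only meaningful for 1 <= i <= size s *)
Definition part (s : seq nat) (i : nat) : nat := nth 0 s i.-1.

Definition is_arndt (s : seq nat) : bool :=
  [forall i : 'I_(size s).+1,
    (0 < i) && (2 * i <= size s) ==> (part s (2 * i - 1) > part s (2 * i))].

(* [last 0 s] is 0 on the empty sequence, so for 0 < m the empty composition
   is never counted *)
Definition is_arndt_last (n m : nat) (s : seq nat) : bool :=
  [&& is_composition n s, is_arndt s & last 0 s == m].

(* Every composition of n has at most n parts, each at most n, so it is
   represented exactly once in the finite type n.-bseq 'I_n.+1: see b_enum *)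
Definition b (n m : nat) : nat :=
  #|[set s : n.-bseq 'I_n.+1 | is_arndt_last n m (map val s)]|.

Fixpoint fib (n : nat) : nat :=
  match n with
  | 0 => 0
  | 1 => 1
  | (n''.+1 as n').+1 => fib n' + fib n''
  end.

Definition t1 (n : nat) : nat :=
  match n with 0 => 1 | 1 => 0 | _ => fib (n - 2) end.

Definition t2 (n : nat) : nat :=
  match n with 0 => 0 | 1 => 1 | _ => fib (n - 1) end.

Lemma is_arndtP (s : seq nat) :
  reflect (forall i, 0 < i -> 2 * i <= size s -> part s (2 * i - 1) > part s (2 * i))
          (is_arndt s).
Proof.
apply: (iffP forallP) => [H i i0 is_ | H i].
  have lt_i : i < (size s).+1.
    by rewrite ltnS (leq_trans _ is_)// mul2n -addnn leq_addr.
  by have /implyP := H (Ordinal lt_i); apply; rewrite /= i0.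
by apply/implyP => /andP[]; apply: H.
Qed.

Lemma composition_bound n s :
  is_composition n s -> (size s <= n) && all (fun x => x < n.+1) s.
Proof.
case/andP=> + /eqP <-; elim: s => //= x s IH /andP[x0 /IH /andP[ss sl]].
rewrite ltnS leq_addr -[(size s).+1]add1n leq_add //=.
by apply: sub_all sl => y; rewrite !ltnS => /leq_trans; apply; apply: leq_addl.
Qed.

Lemma b_enum n m (l : seq (seq nat)) :
  uniq l -> (forall s, (s \in l) = is_arndt_last n m s) -> b n m = size l.
Proof.
move=> ul lE; rewrite /b cardE.
set e := enum _; pose f (s : n.-bseq 'I_n.+1) := map val s.
have fI : injective f by move=> x y /(inj_map val_inj) /val_inj.
rewrite -(size_map f); apply/perm_size/uniq_perm => //.
  by rewrite map_inj_uniq ?enum_uniq.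
move=> s; rewrite lE; apply/mapP/idP => [[x + ->]|Ps].
  by rewrite mem_enum inE.
have /andP[ss sl] : (size s <= n) && all (fun x => x < n.+1) s.
  by apply: composition_bound; case/and3P: Ps.
have ps : size (map (@inord n) s) <= n by rewrite size_map.
have Es : s = f (Bseq ps).
  rewrite /f /= -map_comp -[LHS]map_id; apply/eq_in_map => x xs /=.
  by rewrite inordK //; apply: (allP sl).
by exists (Bseq ps) => //; rewrite mem_enum inE -/(f _) -Es.
Qed.

(* Main.v *)
(** Split the Arndt compositions of [n] with last part [m] by the parity of
    their length.  For odd length, deleting [m] leaves an even-length Arndt
    composition of [n - m].  So [t1 k] has to count the even-length Arndt
    compositions of [k], and [t2 (n - 2 * m)] those of [n] with last part [m].
    Both counts obey recurrences obtained by modifying the last pair [(a, b)],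
    [a > b]:
    - with [b = m] fixed, either [a = m + 1] and the pair can be deleted, or [a]
      can be lowered by one, so the second count is a partial sum of the first;
    - for compositions of [k >= 3], either [b = 1], or both [a] and [b] can be
      lowered by one. *)
Require Import Defs.
From mathcomp Require Import all_boot zify.

Set Implicit Arguments.
Unset Strict Implicit.
Unset Printing Implicit Defensive.

Definition has_card (T : eqType) (P : {pred T}) (c : nat) : Prop :=
  exists2 l : seq T, uniq l /\ l =i P & size l = c.

Section HasCard.
Variable T : eqType.
Implicit Types (P Q : {pred T}) (c d : nat).

Lemma has_card0 P : P =i pred0 -> has_card P 0.
Proof. by move=> P0; exists [::] => //; split=> // x; rewrite P0. Qed.

Lemma has_card1 P x : P =i pred1 x -> has_card P 1.
Proof. by move=> P1; exists [:: x] => //; split=> // y; rewrite P1 !inE. Qed.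

Lemma has_cardID P Q c d :
  has_card [predI P & Q] c -> has_card [predD P & Q] d -> has_card P (c + d).
Proof.
move=> [l [ul lE] <-] [r [ur rE] <-]; exists (l ++ r); last exact: size_cat.
split=> [|x]; last first.
  by rewrite mem_cat lE rE !inE; case: (x \in Q); rewrite ?andbT ?andbF ?orbF.
rewrite cat_uniq ul ur andbT; apply/hasPn => x.
by rewrite /= lE rE !inE => /andP[/negbTE-> _]; rewrite andbF.
Qed.

Lemma has_card_image (U : eqType) (f : T -> U) P (Q : {pred U}) c :
  {in P &, injective f} -> {in P, forall x, f x \in Q} ->
  {in Q, forall y, exists2 x, x \in P & y = f x} ->
  has_card P c -> has_card Q c.
Proof.
move=> f_inj fP fQ [l [ul lE] <-]; exists (map f l); last exact: size_map.
split=> [|y].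
  by rewrite map_inj_in_uniq // => x z; rewrite !lE; apply: f_inj.
apply/mapP/idP => [[x + ->]|/fQ[x Px ->]]; first by rewrite lE; apply: fP.
by exists x; rewrite ?lE.
Qed.

End HasCard.

Lemma last_rev (T : Type) (x : T) s : last x (rev s) = head x s.
Proof. by case: s => [|y s] //; rewrite rev_cons last_rcons. Qed.

Lemma has_card_b n m c : has_card (is_arndt_last n m) c -> b n m = c.
Proof. by case=> l [ul lE] <-; apply: b_enum. Qed.

Lemma is_composition_cons n a s :
  is_composition n (a :: s) = [&& 0 < a, a <= n & is_composition (n - a) s].
Proof. by rewrite /is_composition /=; case: all; lia. Qed.

Lemma is_composition_rev n s : is_composition n (rev s) = is_composition n s.
Proof. by rewrite /is_composition all_rev sumn_rev. Qed.

Lemma is_arndt_rcons s a :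
  is_arndt (rcons s a) = is_arndt s && (odd (size s) ==> (a < last 0 s)).
Proof.
have part_rcons i : i.-1 < size s -> part (rcons s a) i = part s i.
  by move=> lt_is; rewrite /part nth_rcons lt_is.
have part_last : part (rcons s a) (size s).+1 = a.
  by rewrite /part nth_rcons ltnn eqxx.
have part_size : part s (size s) = last 0 s by rewrite /part nth_last.
apply/is_arndtP/andP => [arndt_sa|[/is_arndtP arndt_s last_lt] i i_gt0].
  split; last first.
    apply/implyP => odd_s; have := arndt_sa (uphalf (size s)).
    rewrite size_rcons (_ : 2 * _ = (size s).+1) ?subn1 /=; last by lia.
    by rewrite part_last part_rcons ?part_size; lia.
  apply/is_arndtP => i i_gt0 le_is; have := arndt_sa i i_gt0.
  by rewrite size_rcons !part_rcons; lia.
rewrite size_rcons leq_eqVlt ltnS => /orP[/eqP Ei|le_is].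
  rewrite Ei subn1 /= part_last part_rcons; last by lia.
  by rewrite part_size; apply: (implyP last_lt); lia.
by rewrite !part_rcons; [apply: arndt_s| |]; lia.
Qed.

Lemma is_arndt_last_pred0 n m : n < m -> is_arndt_last n m =i pred0.
Proof.
move=> lt_nm s; apply/negP => /and3P[/andP[_ /eqP sum_s] _ /eqP].
by case/lastP: s sum_s => [|s a]; rewrite ?sumn_rcons ?last_rcons /=; lia.
Qed.

(* Lists are reversed compositions: the last pair [(a, b)] of a composition, on
   which the recurrences act, is the head [b, a] of the list. *)
Definition rev_even_arndt (k : nat) : {pred seq nat} :=
  fun s => [&& is_composition k s, is_arndt (rev s) & ~~ odd (size s)].

Definition rev_even_arndt_last (n m : nat) : {pred seq nat} :=
  fun s => (s \in rev_even_arndt n) && (head 0 s == m).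

Lemma rev_even_arndt_nil k : ([::] \in rev_even_arndt k) = (k == 0).
Proof.
rewrite unfold_in /is_composition /= andbT eq_sym andb_idr // => _.
by apply/is_arndtP => i /=; lia.
Qed.

Lemma rev_even_arndt_cons2 k b a s :
  ([:: b, a & s] \in rev_even_arndt k) =
  [&& 0 < b, b < a, a + b <= k & s \in rev_even_arndt (k - (a + b))].
Proof.
rewrite !unfold_in !is_composition_cons !rev_cons !is_arndt_rcons.
rewrite size_rcons last_rcons size_rev /= negbK -subnDA addnC.
by case: is_composition; case: is_arndt; case: odd => /=; lia.
Qed.

Variant rev_even_arndt_spec k : seq nat -> Prop :=
| RevEvenArndtNil of k = 0 : rev_even_arndt_spec k [::]
| RevEvenArndtCons b a s of 0 < b & b < a & a + b <= k
    & s \in rev_even_arndt (k - (a + b)) : rev_even_arndt_spec k [:: b, a & s].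

Lemma rev_even_arndtP k s : s \in rev_even_arndt k -> rev_even_arndt_spec k s.
Proof.
case: s => [|b [|a s]].
- by rewrite rev_even_arndt_nil => /eqP; constructor.
- by rewrite unfold_in /= !andbF.
- by rewrite rev_even_arndt_cons2 => /and4P[]; constructor.
Qed.

Section FixedLastPart.
Variable m : nat.
Hypothesis m_gt0 : 0 < m.

Lemma rev_even_arndt_lastP n s :
  reflect (exists a t, [/\ s = [:: m, a & t], m < a, a + m <= n
                        & t \in rev_even_arndt (n - (a + m))])
          (s \in rev_even_arndt_last n m).
Proof.
apply: (iffP andP) => [[/rev_even_arndtP[_|b a t b_gt0 lt_ba le_abn Et]]|].
- by move/eqP=> /= m0; move: m_gt0; rewrite -m0.
- by move=> /= /eqP <-; exists a, t.
- move=> [a [t [-> lt_ma le_amn Et]]].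
  by rewrite rev_even_arndt_cons2 m_gt0 lt_ma le_amn.
Qed.

Lemma rev_even_arndt_last_pred0 n :
  n <= 2 * m -> rev_even_arndt_last n m =i pred0.
Proof. by move=> le_n2m s; apply/rev_even_arndt_lastP => -[a [t []]]; lia. Qed.

Lemma has_card_rev_even_arndt_last_rec k c d :
  has_card (rev_even_arndt k) c ->
  has_card (rev_even_arndt_last (2 * m + k) m) d ->
  has_card (rev_even_arndt_last (2 * m + k).+1 m) (c + d).
Proof.
move=> card_c card_d.
apply: (has_cardID (Q := [pred s | nth 0 s 1 == m.+1])).
- apply: (has_card_image (f := fun s => [:: m, m.+1 & s]) _ _ _ card_c).
  + by move=> s t _ _ [].
  + move=> s Es; rewrite !inE eqxx andbT; apply/rev_even_arndt_lastP.
    exists m.+1, s; split=> //; first lia.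
    by rewrite (_ : _ - _ = k) //; lia.
  + move=> s /andP[/rev_even_arndt_lastP[a [t [-> _ _ Et]]] /eqP /= Ea].
    by exists t; rewrite ?Ea // (_ : k = (2 * m + k).+1 - (a + m)) //; lia.
- apply: (has_card_image (f := incr_nth^~ 1) _ _ _ card_d).
  + move=> s t /rev_even_arndt_lastP[a [s' [-> _ _ _]]].
    by move=> /rev_even_arndt_lastP[b [t' [-> _ _ _]]] [-> ->].
  + move=> s /rev_even_arndt_lastP[a [t [-> lt_ma le_am Et]]].
    rewrite !inE /=; apply/andP; split; first lia.
    by apply/rev_even_arndt_lastP; exists a.+1, t; split=> //; lia.
  + move=> s; rewrite !inE andbC.
    case/andP=> /rev_even_arndt_lastP[a [t [-> lt_ma le_am Et]]] /= neq_am.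
    exists [:: m, a.-1 & t]; last by rewrite /= prednK //; lia.
    apply/rev_even_arndt_lastP; exists a.-1, t.
    by rewrite (_ : _ - _ = (2 * m + k).+1 - (a + m)); [split=> // | ]; lia.
Qed.

Lemma has_card_rev_even_arndt_last_sum k (c : nat -> nat) :
  (forall i, i < k -> has_card (rev_even_arndt i) (c i)) ->
  has_card (rev_even_arndt_last (2 * m + k) m) (\sum_(i < k) c i).
Proof.
elim: k => [|k IHk] card_lt.
  by rewrite big_ord0 addn0; apply/has_card0/rev_even_arndt_last_pred0.
rewrite addnS big_ord_recr /= [_ + c k]addnC.
apply: has_card_rev_even_arndt_last_rec.
  exact: card_lt.
by apply: IHk => i lt_ik; apply/card_lt/ltnW.
Qed.

End FixedLastPart.

Lemma has_card_rev_even_arndt_rec k c d :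
  has_card (rev_even_arndt_last k.+3 1) c -> has_card (rev_even_arndt k.+1) d ->
  has_card (rev_even_arndt k.+3) (c + d).
Proof.
move=> card_c card_d; apply: (has_cardID (Q := [pred s | head 0 s == 1])) => //.
apply: (has_card_image (f := fun s => incr_nth (incr_nth s 0) 1) _ _ _ card_d).
- move=> s t /rev_even_arndtP[//|b a s' _ _ _ _].
  by case/rev_even_arndtP=> [//|b' a' t' _ _ _ _] [-> -> ->].
- move=> s /rev_even_arndtP[//|b a t b_gt0 lt_ba le_abk Et].
  by rewrite !inE /= rev_even_arndt_cons2 addnS addSn !subSS Et; lia.
- move=> s; rewrite !inE andbC.
  case/andP=> /rev_even_arndtP[//|b a t b_gt0 lt_ba le_abk Et] /= neq_b1.
  exists [:: b.-1, a.-1 & t]; last by rewrite /= !prednK //; lia.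
  by rewrite rev_even_arndt_cons2 (_ : _ - _ = k.+3 - (a + b)) ?Et; lia.
Qed.

Lemma sum_t1 k : \sum_(i < k) t1 i = t2 k.
Proof.
elim: k => [|k IHk]; first by rewrite big_ord0.
rewrite big_ord_recr /= {}IHk.
by case: k => [|[|k]] //; rewrite /t1 /t2 !subSS !subn0.
Qed.

Lemma t1SSS n : t1 n.+3 = t2 n.+1 + t1 n.+1.
Proof. by case: n => [|n] //; rewrite /t1 /t2 !subSS !subn0. Qed.

Lemma has_card_rev_even_arndt k : has_card (rev_even_arndt k) (t1 k).
Proof.
elim/ltn_ind: k => -[_|[_|[_|k IHk]]].
- apply: (@has_card1 _ _ [::]) => s; apply/idP/eqP => [|->].
    by case/rev_even_arndtP => // b a t; lia.
  by rewrite rev_even_arndt_nil.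
- by apply: has_card0 => s; apply/negP => /rev_even_arndtP[|b a t]; lia.
- by apply: has_card0 => s; apply/negP => /rev_even_arndtP[|b a t]; lia.
rewrite t1SSS; apply: has_card_rev_even_arndt_rec; last exact: IHk.
rewrite -sum_t1.
apply: (@has_card_rev_even_arndt_last_sum 1 _ k.+1) => // i lt_ik.
by apply: IHk; lia.
Qed.

Lemma has_card_rev_even_arndt_last n m :
  0 < m -> has_card (rev_even_arndt_last n m) (t2 (n - 2 * m)).
Proof.
move=> m_gt0; have [le_2mn|lt_n2m] := leqP (2 * m) n.
  rewrite -sum_t1 -{1}(subnKC le_2mn).
  apply: has_card_rev_even_arndt_last_sum => // i _.
  exact: has_card_rev_even_arndt.
rewrite (eqP (ltnW lt_n2m)).
by apply/has_card0/rev_even_arndt_last_pred0 => //; apply: ltnW.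
Qed.

Lemma rev_even_arndt_lastE n m s :
  (s \in rev_even_arndt_last n m) =
  (rev s \in [predD is_arndt_last n m & odd \o size]).
Proof.
rewrite !inE !unfold_in /= is_composition_rev last_rev size_rev.
by rewrite andbC -!andbA; do !bool_congr.
Qed.

Lemma rev_cons_odd_arndt_last n m a s : 0 < m -> m <= n ->
  (rev (a :: s) \in [predI is_arndt_last n m & odd \o size]) =
  (a == m) && (s \in rev_even_arndt (n - m)).
Proof.
move=> m_gt0 le_mn.
rewrite !inE !unfold_in /= is_composition_rev is_composition_cons last_rev.
rewrite rev_cons is_arndt_rcons size_rcons size_rev /=.
by case: eqP => [->|_]; case: odd; rewrite ?m_gt0 ?le_mn ?andbF ?andbT.
Qed.

Lemma has_card_even_arndt_last n m :
  0 < m -> has_card [predD is_arndt_last n m & odd \o size] (t2 (n - 2 * m)).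
Proof.
move=> m_gt0; have := has_card_rev_even_arndt_last n m_gt0.
apply: (has_card_image (f := rev)) => [s t _ _|s|s].
- exact: (can_inj revK).
- by rewrite rev_even_arndt_lastE.
- by exists (rev s); rewrite ?rev_even_arndt_lastE revK.
Qed.

Lemma has_card_odd_arndt_last n m : 0 < m -> m <= n ->
  has_card [predI is_arndt_last n m & odd \o size] (t1 (n - m)).
Proof.
move=> m_gt0 le_mn; have := has_card_rev_even_arndt (n - m).
apply: (has_card_image (f := rev \o cons m)) => [s t _ _|s Es|s].
- by move/(can_inj revK) => [].
- by rewrite rev_cons_odd_arndt_last ?eqxx.
- rewrite -[s]revK; case: (rev s) => [|a t]; first by rewrite inE andbF.
  by rewrite rev_cons_odd_arndt_last // => /andP[/eqP -> Et]; exists t.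
Qed.

Theorem theorem3p2 (n m : nat) (hn : 1 <= n) (hm : 1 <= m) :
  b n m = if m <= n < 2 * m then t1 (n - m)
          else if 2 * m <= n then t1 (n - m) + t2 (n - 2 * m)
          else 0.
Proof.
have [le_mn|lt_nm] := leqP m n; last first.
  have /negbTE-> : ~~ (2 * m <= n) by lia.
  exact/has_card_b/has_card0/is_arndt_last_pred0.
have -> : b n m = t1 (n - m) + t2 (n - 2 * m).
  apply/has_card_b/has_cardID; first exact: has_card_odd_arndt_last.
  exact: has_card_even_arndt_last.
by case: leqP => //= lt_n2m; rewrite (eqP (ltnW lt_n2m)) addn0.
Qed.
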